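(* Let $c\ge 3$, $b\ge 1$ be integers. The spectrum of the clique $2$-down Laplacian $\delta_{1}\delta_{1}^T$ of $G_{c,b}$ consists of the eigenvalue $0$ with multiplicity $\binom{c}{3}+(b-1)\binom{c-1}{2}$, the eigenvalue $c$ with multiplicity $(b-1)(c-1)$, and the eigenvalue $b+c$ with multiplicity $\binom{c}{2}$ (eigenvalues listed with multiplicity $0$ being omitted).
   Context: $G_{c,b}$ is the graph on vertex set $\{1,\dots,b+c\}$ (with the natural order) with edges $\{i,j\}$ for $1\le i<j\le c$ and $\{i,j\}$ for $c+1\le i\le c+b$, $1\le j\le c$ (i.e. $K_c$ joined to $b$ independent vertices). $\mathcal T_{c,b}$ is the set of all triangles ($3$-cliques) of $G_{c,b}$. For $T=\{a,b',c'\}$ with $a<b'<c'$ and an edge $e$, $[T:e]$ is $1$ if $e=\{a,b'\}$ or $\{b',c'\}$, $-1$ if $e=\{a,c'\}$, $0$ if $e\not\subset T$; $\delta_1$ is the $\mathcal T_{c,b}\times E(G_{c,b})$ matrix with entries $[T:e]$, and the clique $2$-down Laplacian is $\delta_1\delta_1^T$. *)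

(* Defs.v *)
From mathcomp Require Import all_boot all_order all_algebra.

Set Implicit Arguments.
Unset Strict Implicit.
Unset Printing Implicit Defensive.

Import GRing.Theory.
Local Open Scope ring_scope.

(* A graph on {1, ..., n} is given by its set of edges, each edge being a
   two-element set of vertices; vertex k is represented by k - 1 : 'I_n. *)

Definition triangles n (E : {set {set 'I_n}}) : {set {set 'I_n}} :=
  [set T : {set 'I_n} | (#|T| == 3%N) &&
    [forall i in T, forall j in T, (i != j) ==> ([set i; j] \in E)]].

Definition incidence (R : pzRingType) n (T e : {set 'I_n}) : R :=
  if [exists x : 'I_n, exists y : 'I_n, exists z : 'I_n,
       [&& (x < y)%N, (y < z)%N, T == [set x; y; z]
         & (e == [set x; y]) || (e == [set y; z])]] then 1
  else if [exists x : 'I_n, exists y : 'I_n, exists z : 'I_n,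
       [&& (x < y)%N, (y < z)%N, T == [set x; y; z]
         & e == [set x; z]]] then -1
  else 0.

Definition coboundary1 (R : pzRingType) n (E : {set {set 'I_n}}) :
    'M[R]_(#|triangles E|, #|E|) :=
  \matrix_(i, j) incidence R (enum_val i) (enum_val j).

Definition down_laplacian2 (R : pzRingType) n (E : {set {set 'I_n}}) :
    'M[R]_#|triangles E| :=
  coboundary1 R E *m (coboundary1 R E)^T.

Definition Gedges (c b : nat) : {set {set 'I_(b + c)}} :=
  [set e : {set 'I_(b + c)} |
    [exists i : 'I_(b + c), exists j : 'I_(b + c),
      (e == [set i; j]) && (((i < j)%N && (j < c)%N)
                            || ((c <= i)%N && (j < c)%N))]].

(* s lists the eigenvalues of A with multiplicity. Algebraic and geometric
   multiplicities agree for real symmetric matrices, so both are required. *)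
Definition has_spectrum (F : fieldType) n (A : 'M[F]_n) (s : seq F) : Prop :=
  char_poly A = \prod_(a <- s) ('X - a%:P)
  /\ forall x : F, \rank (eigenspace A x) = count_mem x s.

(* Main.v *)
Require Import Defs.
From mathcomp Require Import all_boot all_order all_algebra.
From mathcomp Require Import zify ring.

(** Let C be the clique of a complete split graph on n vertices, c = #|C|, and let
    L be the 2-down Laplacian.  A row vector u on the triangles has a boundary f,
    an antisymmetric function on ordered edges whose values at the edges leaving
    any vertex sum to 0, and u *m L depends only on f.  Passing from u to u *m L
    multiplies f by n inside C and sends f x y to c f x y + sum_(q notin C) f x q on
    an edge from x in C to y outside C.  Hence L (L - c) (L - n) = 0, so L is
    diagonalizable with eigenvalues among 0, c and n.  Being a cycle, f is
    determined by its values on the edges avoiding one vertex of C, and after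
    applying L - c by those inside C; this bounds the rank of L and the multiplicity
    of n from above.  The trace of L is three times the number of triangles, which
    forces both bounds to be attained. *)

Set Implicit Arguments.
Unset Strict Implicit.
Unset Printing Implicit Defensive.

Import GRing.Theory Num.Theory.
Local Open Scope ring_scope.

(** * Spectra of diagonalizable matrices *)

Lemma leq_mxrank_kermx (F : fieldType) (m p q : nat) (A : 'M[F]_(m, p))
    (B : 'M[F]_(m, q)) :
  (kermx B <= kermx A)%MS -> (\rank A <= \rank B)%N.
Proof.
move/mxrankS; rewrite !mxrank_ker.
by have := rank_leq_row A; have := rank_leq_row B; lia.
Qed.

Lemma rank_diag_mx (F : fieldType) (n : nat) (d : 'rV[F]_n) :
  \rank (diag_mx d) = count (predC1 0) [seq d 0 i | i <- enum 'I_n].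
Proof.
rewrite count_map -sum1_count big_enum_cond /= big_mkcond /=.
elim: n d => [|n IHn] d; first by rewrite thinmx0 mxrank0 big_ord0.
have rank1 (a : 'rV[F]_1) : \rank (diag_mx a) = if a 0 0 != 0 then 1%N else 0%N.
  rewrite (_ : diag_mx a = a) ?rank_rV; last by apply/rowP => j; rewrite !mxE !ord1.
  have -> : (a == 0) = (a 0 0 == 0).
    by apply/eqP/eqP => [->|a0]; [rewrite mxE | rewrite [a]mx11_scalar a0 raddf0].
  by case: eqP.
pose dl := lsubmx (d : 'rV_(1 + n)); pose dr := rsubmx (d : 'rV_(1 + n)).
have -> : diag_mx d = block_mx (diag_mx dl) 0 0 (diag_mx dr) :> 'M_(1 + n).
  by rewrite -diag_mx_row hsubmxK.
transitivity (\rank (diag_mx dl) + \rank (diag_mx dr))%N.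
  exact: (rank_diag_block_mx (diag_mx dl) (diag_mx dr)).
rewrite IHn rank1 big_ord_recl mxE lshift0; congr (_ + _)%N.
by apply: eq_bigr => i _; rewrite mxE rshift1.
Qed.

Lemma has_spectrum_diag_mx (F : fieldType) (n : nat) (d : 'rV[F]_n) :
  has_spectrum (diag_mx d) [seq d 0 i | i <- enum 'I_n].
Proof.
split=> [|x].
  rewrite (char_poly_trig (diag_mx_is_trig d)) big_map big_enum.
  by apply: eq_bigr => i _; rewrite mxE eqxx mulr1n.
pose p := [pred i | d 0 i == x].
have rankE : \rank (diag_mx d - x%:M) = count (predC p) (enum 'I_n).
  rewrite -diag_const_mx -raddfB rank_diag_mx count_map.
  by apply: eq_count => i; rewrite /= !mxE subr_eq0.
rewrite /eigenspace mxrank_ker rankE -[X in (X - _)%N]size_enum_ord.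
by rewrite -(count_predC p) addnK [RHS]count_map.
Qed.

Lemma has_spectrum_similar (F : fieldType) (n : nat) (P A B : 'M[F]_n) (s : seq F) :
  P \in unitmx -> P *m A = B *m P -> has_spectrum B s -> has_spectrum A s.
Proof.
move=> uP PA [charB rankB]; split=> [|x].
  have /mulfI : \det (map_mx polyC P) != 0.
    by rewrite det_map_mx polyC_eq0 -unitfE -unitmxE.
  apply; rewrite -charB -det_mulmx mulrC -det_mulmx !mulmxBr !mulmxBl.
  by rewrite -!map_mxM PA scalar_mxC.
rewrite -rankB /eigenspace !mxrank_ker; congr (_ - _)%N.
have -> : \rank (A - x%:M) = \rank (P *m (A - x%:M)).
  by rewrite eqmxMfull // row_full_unit.
by rewrite mulmxBr PA scalar_mxC -mulmxBl mxrankMfree ?row_free_unit.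
Qed.

Lemma diagonalizable_has_spectrum (F : fieldType) (n : nat) (A : 'M[F]_n) :
  diagonalizable A -> exists s : seq F, has_spectrum A s.
Proof.
case=> P uP /similar_diagPex[d /(similarP uP) PA].
exists [seq d 0 i | i <- enum 'I_n].
exact: has_spectrum_similar uP PA (has_spectrum_diag_mx d).
Qed.

Lemma annihilated_diagonalizable (F : fieldType) (n : nat) (A : 'M[F]_n) (rs : seq F) :
  uniq rs -> \prod_(x <- rs) (A - x%:M) = 0 -> diagonalizable A.
Proof.
case: n A => [|n] A rs_uniq A0; first by rewrite [A]thinmx0; exact: diagonalizable0.
apply/diagonalizableP; exists rs => //; rewrite mxminpoly_min // rmorph_prod -[RHS]A0.
by apply: eq_bigr => x _; rewrite rmorphB /= horner_mx_X horner_mx_C.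
Qed.

Lemma annihilated_spectrum_sub (F : fieldType) (n : nat) (A : 'M[F]_n) (rs s : seq F) :
  \prod_(x <- rs) (A - x%:M) = 0 -> has_spectrum A s -> {subset s <= rs}.
Proof.
move=> A0 [_ rankA] a; rewrite -has_pred1 has_count -rankA lt0n mxrank_eq0.
case/rowV0Pn => u /eigenspaceP uA u_neq0.
have uprod (t : seq F) :
    u *m \prod_(x <- t) (A - x%:M) = (\prod_(x <- t) (a - x)) *: u.
  elim: t => [|x t IHt]; first by rewrite !big_nil mulmx1 scale1r.
  rewrite !big_cons mulmxA mulmxBr uA mul_mx_scalar -scalerBl -scalemxAl IHt.
  by rewrite scalerA.
have /esym/eqP := uprod rs; rewrite A0 mulmx0 scaler_eq0 (negPf u_neq0) orbF.
by rewrite prodf_seq_eq0 => /hasP[x x_rs]; rewrite subr_eq0 => /eqP->.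
Qed.

Lemma perm_eq_count_flatten (T : eqType) (rs s : seq T) :
    uniq rs -> {subset s <= rs} ->
  perm_eq s (flatten [seq nseq (count_mem x s) x | x <- rs]).
Proof.
move=> rs_uniq s_rs; apply/allP => a _ /=.
rewrite count_flatten -map_comp sumnE big_map.
under eq_bigr do rewrite /= count_nseq.
have [a_rs|a_rs] := boolP (a \in rs).
  rewrite (bigD1_seq a) //= eqxx mul1n big1 ?addn0 // => x /negPf xa.
  by rewrite xa mul0n.
rewrite (count_memPn (contra (@s_rs a) a_rs)) big1_seq // => x /andP[_ x_rs].
by rewrite /= (_ : (x == a) = false) //; apply: contraNF a_rs => /eqP<-.
Qed.

Lemma annihilated_has_spectrum (F : fieldType) (n : nat) (A : 'M[F]_n) (rs : seq F) :
    uniq rs -> \prod_(x <- rs) (A - x%:M) = 0 ->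
  has_spectrum A (flatten [seq nseq (\rank (eigenspace A x)) x | x <- rs]).
Proof.
move=> rs_uniq A0.
have [s sA] := diagonalizable_has_spectrum (annihilated_diagonalizable rs_uniq A0).
have [charA rankA] := sA.
have := perm_eq_count_flatten rs_uniq (annihilated_spectrum_sub A0 sA).
under eq_map do rewrite -rankA; move=> s_perm.
by split=> [|x]; [rewrite charA; exact: perm_big | rewrite rankA; exact/permP].
Qed.

Lemma has_spectrum_size (F : fieldType) (n : nat) (A : 'M[F]_n) (s : seq F) :
  has_spectrum A s -> size s = n.
Proof.
by case=> charA _; apply: succn_inj; rewrite -(size_char_poly A) charA size_prod_XsubC.
Qed.

Lemma has_spectrum_trace (F : fieldType) (n : nat) (A : 'M[F]_n) (s : seq F) :
  has_spectrum A s -> \tr A = \sum_(a <- s) a.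
Proof.
move=> sA; have sizes := has_spectrum_size sA; case: n A sA sizes => [|n] A sA.
  by move/size0nil->; rewrite big_nil [A]thinmx0 raddf0.
move=> sizes; apply: oppr_inj; rewrite -char_poly_trace // -coefPn_prod_XsubC sizes //.
by case: sA => ->.
Qed.

Lemma has_spectrum_rank (F : fieldType) (n : nat) (A : 'M[F]_n) (s : seq F) :
  has_spectrum A s -> \rank A = count (predC1 0) s.
Proof.
move=> sA; have [_ /(_ 0)] := sA; rewrite /eigenspace mxrank_ker raddf0 subr0 => ker0.
apply: (@addnI (count_mem 0 s)); rewrite [RHS]count_predC (has_spectrum_size sA) -ker0.
by rewrite subnK ?rank_leq_row.
Qed.

(** * Incidence of edges in triangles *)

Lemma uniq3 (T : eqType) (x y z : T) :
  uniq [:: x; y; z] = [&& x != y, x != z & y != z].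
Proof. by rewrite /= !inE negb_or andbT -andbA. Qed.

Lemma cards3_uniq (T : finType) (x y z : T) :
  (#|[set x; y; z]| == 3%N) = uniq [:: x; y; z].
Proof.
rewrite (eq_card (_ : _ =i [:: x; y; z])) ?(sameP eqP card_uniqP) // => t.
by rewrite !inE orbA.
Qed.

Lemma cards3_pair (T : finType) (A : {set T}) (x y : T) :
    #|A| = 3%N -> x \in A -> y \in A -> x != y ->
  exists2 z, uniq [:: x; y; z] & A = [set x; y; z].
Proof.
move=> A3 xA yA xy; have yAx : y \in A :\ x by rewrite !inE eq_sym xy.
have /cards1P[z Axy] : #|A :\ x :\ y| == 1.
  by move: A3; rewrite (cardsD1 x) xA (cardsD1 y) yAx; lia.
have AE : A = [set x; y; z] by rewrite -(setD1K xA) -(setD1K yAx) Axy setUA.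
by exists z; rewrite // -cards3_uniq -AE A3.
Qed.

Lemma cards3P (T : finType) (A : {set T}) :
  reflect (exists x y z, uniq [:: x; y; z] /\ A = [set x; y; z]) (#|A| == 3%N).
Proof.
apply: (iffP eqP) => [A3|[x [y [z [xyz ->]]]]]; last by apply/eqP; rewrite cards3_uniq.
have /card_gt1P[x [y [xA yA xy]]] : (1 < #|A|)%N by rewrite A3.
by have [z] := cards3_pair A3 xA yA xy; exists x, y, z.
Qed.

Lemma set2_eqF (T : finType) (a b c d : T) :
  a != c -> a != d -> ([set a; b] == [set c; d]) = false.
Proof.
by move=> ac ad; apply/eqP => /setP/(_ a); rewrite !inE eqxx (negPf ac) (negPf ad).
Qed.

Lemma set3C (T : finType) (x y z : T) : [set x; y; z] = [set y; x; z].
Proof. by rewrite [[set x; y]]setUC. Qed.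

Lemma set3_rot (T : finType) (x y z : T) : [set x; y; z] = [set y; z; x].
Proof. by rewrite -setUA setUC. Qed.

Lemma ord3_sorted_ind (n : nat) (P : 'I_n -> 'I_n -> 'I_n -> Prop) :
    (forall x y z, P x y z -> P y x z) -> (forall x y z, P x y z -> P y z x) ->
    (forall x y z : 'I_n, (x < y)%N -> (y < z)%N -> P x y z) ->
  forall x y z, uniq [:: x; y; z] -> P x y z.
Proof.
move=> swapP rotP sortedP x y z; rewrite uniq3 -!val_eqE /= => xyz.
have [xy|yx|xy] := ltngtP x y; have [yz|zy|yz] := ltngtP y z;
  have [xz|zx|xz] := ltngtP x z; try lia.
- exact: sortedP.
- by apply/swapP/rotP/rotP/sortedP.
- by apply/rotP/sortedP.
- by apply/swapP/sortedP.
- by apply/rotP/rotP/sortedP.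
- by apply/swapP/rotP/sortedP.
Qed.

Lemma exists_set3_sorted (n : nat) (x y z : 'I_n) (Q : 'I_n -> 'I_n -> 'I_n -> bool) :
    (x < y)%N -> (y < z)%N ->
  [exists a : 'I_n, exists b : 'I_n, exists c : 'I_n,
    [&& (a < b)%N, (b < c)%N, [set x; y; z] == [set a; b; c] & Q a b c]] = Q x y z.
Proof.
move=> xy yz; apply/existsP/idP => [[a /existsP[b /existsP[c]]]|Qxyz]; last first.
  by exists x; apply/existsP; exists y; apply/existsP; exists z; rewrite xy yz eqxx.
case/and4P=> ab bc /eqP/setP abcE.
suff [-> [-> ->]] : x = a /\ y = b /\ z = c by [].
move: (abcE x) (abcE y) (abcE z) (abcE a) (abcE b) (abcE c).
rewrite !inE !eqxx ?orbT /= -!val_eqE /= => *.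
by do ?split; apply: val_inj => /=; lia.
Qed.

Lemma incidence_sorted (R : pzRingType) (n : nat) (x y z : 'I_n) (e : {set 'I_n}) :
    (x < y)%N -> (y < z)%N ->
  incidence R [set x; y; z] e =
    (e == [set x; y])%:R + (e == [set y; z])%:R - (e == [set x; z])%:R.
Proof.
move=> xy yz; rewrite /incidence.
rewrite (exists_set3_sorted (fun a b c => (e == [set a; b]) || (e == [set b; c]))) //.
rewrite (exists_set3_sorted (fun a _ c => e == [set a; c])) //.
have xy_neq : x != y by rewrite -val_eqE /= ltn_eqF.
have yz_neq : y != z by rewrite -val_eqE /= ltn_eqF.
have xz_neq : x != z by rewrite -val_eqE /= ltn_eqF // (ltn_trans xy yz).
case: eqP => [->|_] /=.
  rewrite set2_eqF // [[set x; y]]setUC set2_eqF 1?(eq_sym y x) // ?mulr0n.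
  by rewrite addr0 subr0.
case: eqP => [->|_] /=; first by rewrite set2_eqF 1?(eq_sym y x) // !mulr0n add0r subr0.
by case: eqP => _; rewrite !mulr0n addr0 ?subr0 ?sub0r.
Qed.

Lemma incidence_not_sub (R : pzRingType) (n : nat) (T e : {set 'I_n}) :
  ~~ (e \subset T) -> incidence R T e = 0.
Proof.
move=> eT; rewrite /incidence.
case: existsP => [[x /existsP[y /existsP[z /and4P[_ _ /eqP TE]]]]|_].
  by case/orP=> /eqP eE; rewrite TE eE subUset !sub1set !inE !eqxx !orbT in eT.
case: existsP => [[x /existsP[y /existsP[z /and4P[_ _ /eqP TE /eqP eE]]]]|//].
by rewrite TE eE subUset !sub1set !inE !eqxx !orbT in eT.
Qed.

Definition osign (R : pzRingType) (n : nat) (x y : 'I_n) : R :=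
  (x < y)%N%:R - (y < x)%N%:R.

Lemma osignC (R : pzRingType) (n : nat) (x y : 'I_n) : osign R y x = - osign R x y.
Proof. by rewrite /osign opprB. Qed.

Lemma osign_refl (R : pzRingType) (n : nat) (x : 'I_n) : osign R x x = 0.
Proof. by rewrite /osign subrr. Qed.

Lemma osign_lt (R : pzRingType) (n : nat) (x y : 'I_n) : (x < y)%N -> osign R x y = 1.
Proof. by move=> xy; rewrite /osign xy ltnNge ltnW //= subr0. Qed.

Lemma osign_sqr (R : pzRingType) (n : nat) (x y : 'I_n) :
  x != y -> osign R x y * osign R x y = 1.
Proof.
rewrite -val_eqE /= neq_ltn => /orP[xy|yx]; first by rewrite osign_lt ?mulr1.
by rewrite osignC mulrNN osign_lt ?mulr1.
Qed.

Definition osign3 (R : pzRingType) (n : nat) (x y z : 'I_n) : R :=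
  osign R x y * osign R y z * osign R x z.

Lemma osign3C (R : comPzRingType) (n : nat) (x y z : 'I_n) :
  osign3 R y x z = - osign3 R x y z.
Proof. by rewrite /osign3 (osignC R x y); ring. Qed.

Lemma osign3_rot (R : comPzRingType) (n : nat) (x y z : 'I_n) :
  osign3 R y z x = osign3 R x y z.
Proof. by rewrite /osign3 (osignC R x y) (osignC R x z); ring. Qed.

Lemma osign3K (R : comPzRingType) (n : nat) (x y z : 'I_n) :
  uniq [:: x; y; z] -> involutive ( *%R (osign3 R x y z)).
Proof.
rewrite uniq3 => /and3P[xy xz yz] a.
transitivity ((osign R x y * osign R x y) * (osign R y z * osign R y z)
              * (osign R x z * osign R x z) * a); first by rewrite /osign3; ring.
by rewrite !osign_sqr // !mul1r.
Qed.

(* Both sides change by the sign of a permutation of the vertices, which reduces the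
   formula to sorted triangles. *)
Lemma incidence_set3 (R : comPzRingType) (n : nat) (x y z : 'I_n) (e : {set 'I_n}) :
    uniq [:: x; y; z] ->
  osign3 R x y z * incidence R [set x; y; z] e =
    osign R x y * (e == [set x; y])%:R + osign R y z * (e == [set y; z])%:R
    + osign R z x * (e == [set z; x])%:R.
Proof.
move: x y z; apply: ord3_sorted_ind => x y z.
- move=> xyzE; rewrite set3C osign3C mulNr xyzE.
  rewrite [[set y; x]]setUC [[set x; z]]setUC [[set z; y]]setUC.
  by rewrite (osignC R x y) (osignC R y z) (osignC R z x); ring.
- by move=> xyzE; rewrite -set3_rot osign3_rot xyzE; ring.
- move=> xy yz; have xz := ltn_trans xy yz.
  rewrite incidence_sorted // /osign3 (osignC R x z) !osign_lt // [[set z; x]]setUC.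
  by ring.
Qed.

Lemma osign_incidence (R : comPzRingType) (n : nat) (x y z : 'I_n) :
    uniq [:: x; y; z] ->
  osign R x y * incidence R [set x; y; z] [set x; y] = osign3 R x y z.
Proof.
move=> xyz; have := xyz; rewrite uniq3 => /and3P[xy xz yz].
have osign3_inc : osign3 R x y z * incidence R [set x; y; z] [set x; y] = osign R x y.
  rewrite incidence_set3 // eqxx set2_eqF // [[set x; y]]setUC.
  by rewrite set2_eqF 1?(eq_sym y x) // !mulr0 !addr0 mulr1.
rewrite -[incidence _ _ _](osign3K xyz) osign3_inc.
by rewrite mulrCA osign_sqr // mulr1.
Qed.

Lemma sum_osign_incidence (R : comPzRingType) (n : nat) (T : {set 'I_n}) (x y : 'I_n) :
    #|T| = 3%N ->
  osign R x y * incidence R T [set x; y] =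
    \sum_z osign3 R x y z * (T == [set x; y; z])%:R.
Proof.
move=> T3; have [xy|xy] := eqVneq x y.
  by rewrite xy osign_refl mul0r big1 // => z _; rewrite /osign3 osign_refl !mul0r.
have [/andP[xT yT]|xyT] := boolP ((x \in T) && (y \in T)); last first.
  rewrite incidence_not_sub ?subUset ?sub1set // mulr0 big1 // => z _.
  by case: eqP xyT => [->|_]; rewrite ?mulr0 // !inE !eqxx !orbT.
have [z xyz ->] := cards3_pair T3 xT yT xy.
rewrite osign_incidence // (bigD1 z) //= eqxx mulr1 big1 ?addr0 // => w wz.
case: eqP => [/setP/(_ z)|_]; last by rewrite mulr0.
move: xyz; rewrite uniq3 !inE eqxx orbT => /and3P[_ xz yz].
by rewrite (eq_sym z x) (negPf xz) (eq_sym z y) (negPf yz) eq_sym (negPf wz).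
Qed.

(** * Boundaries of 2-chains *)

Lemma set3_triangle (n : nat) (E : {set {set 'I_n}}) (x y z : 'I_n) :
  ([set x; y; z] \in triangles E) =
    [&& uniq [:: x; y; z], [set x; y] \in E, [set y; z] \in E & [set z; x] \in E].
Proof.
rewrite inE cards3_uniq uniq3; case: and3P => //= -[xy xz yz].
apply/forall_inP/and3P => [cliqueE|[Exy Eyz Ezx] i].
  have edge i j : i \in [set x; y; z] -> j \in [set x; y; z] -> i != j ->
      [set i; j] \in E by move=> /cliqueE/forall_inP/(_ _)/[apply]/implyP.
  by split; apply: edge; rewrite // 1?eq_sym // !inE eqxx ?orbT.
rewrite !inE => iT; apply/forall_inP => j; rewrite !inE => jT; apply/implyP.
by case/orP: iT => [/orP[]|] /eqP->; case/orP: jT => [/orP[]|] /eqP->;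
  rewrite ?eqxx // setUC.
Qed.

Lemma card_triangle (n : nat) (E : {set {set 'I_n}}) (t : 'I_#|triangles E|) :
  #|enum_val t| = 3%N.
Proof. by have := enum_valP t; rewrite inE => /andP[/eqP]. Qed.

Lemma triangle_set3 (n : nat) (E : {set {set 'I_n}}) (t : 'I_#|triangles E|) :
  exists x y z, uniq [:: x; y; z] /\ enum_val t = [set x; y; z].
Proof. exact/cards3P/eqP/card_triangle. Qed.

Lemma sum_skew (V : zmodType) (n : nat) (A : 'I_n -> 'I_n -> V) :
    (forall i, A i i = 0) -> (forall i j, A j i = - A i j) ->
  \sum_i \sum_j A i j = 0.
Proof.
move=> A0 AC.
have splitA i : \sum_j A i j =
    \sum_(j < n | (j < i)%N) A i j + \sum_(j < n | (i < j)%N) A i j.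
  rewrite (bigID (fun j : 'I_n => (j < i)%N)) /=.
  rewrite [X in _ + X](bigD1 i) ?ltnn //= A0 add0r.
  by congr (_ + _); apply: eq_bigl => j; rewrite -val_eqE /=; lia.
under eq_bigr do rewrite splitA.
rewrite big_split /= (exchange_big_dep predT) //= -big_split big1 // => i _ /=.
by rewrite -big_split big1 // => j _; rewrite /= (AC i j) addNr.
Qed.

Section Boundary.

Variables (R : comPzRingType) (n : nat) (E : {set {set 'I_n}}).
Implicit Types (u v : 'rV[R]_#|triangles E|) (x y z : 'I_n) (t : 'I_#|triangles E|).

(* The row vector [u *m coboundary1 R E], extended antisymmetrically to ordered
   pairs of vertices. *)
Definition boundary u : 'M[R]_n :=
  \matrix_(x, y) \sum_t u 0 t * (osign R x y * incidence R (enum_val t) [set x; y]).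

Lemma boundaryBZ a u v x y :
  boundary (v - a *: u) x y = boundary v x y - a * boundary u x y.
Proof.
rewrite !mxE mulr_sumr -sumrB; apply: eq_bigr => t _.
by rewrite !mxE mulrBl -mulrA.
Qed.

Lemma boundaryC u x y : boundary u y x = - boundary u x y.
Proof.
by rewrite !mxE -sumrN; apply: eq_bigr => t _; rewrite setUC osignC mulNr mulrN.
Qed.

Lemma boundary_refl u x : boundary u x x = 0.
Proof. by rewrite mxE big1 // => t _; rewrite osign_refl mul0r mulr0. Qed.

Lemma boundary_nonedge u x y : [set x; y] \notin E -> boundary u x y = 0.
Proof.
move=> xyE; have [->|xy] := eqVneq x y; first exact: boundary_refl.
rewrite mxE big1 // => t _; rewrite incidence_not_sub ?mulr0 //.
apply: contra xyE; rewrite subUset !sub1set => /andP[xt yt].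
have [z _ tE] := cards3_pair (card_triangle t) xt yt xy.
by have := enum_valP t; rewrite tE set3_triangle => /and4P[].
Qed.

Definition oriented_value u x y z : R :=
  osign3 R x y z * \sum_t u 0 t * (enum_val t == [set x; y; z])%:R.

Lemma oriented_valueE u t x y z :
  enum_val t = [set x; y; z] -> oriented_value u x y z = osign3 R x y z * u 0 t.
Proof.
move=> tE; rewrite /oriented_value (bigD1 t) //= tE eqxx mulr1 big1 ?addr0 // => s st.
by rewrite -tE (inj_eq enum_val_inj) (negPf st) mulr0.
Qed.

Lemma oriented_value_eq0 u x y z :
  [set x; y; z] \notin triangles E -> oriented_value u x y z = 0.
Proof.
move=> xyzE; rewrite /oriented_value big1 ?mulr0 // => t _.
by case: eqP xyzE => [<-|_]; rewrite ?mulr0 // enum_valP.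
Qed.

Lemma boundary_sum u x y : boundary u x y = \sum_z oriented_value u x y z.
Proof.
rewrite mxE /oriented_value; under [RHS]eq_bigr do rewrite mulr_sumr.
rewrite exchange_big; apply: eq_bigr => t _ /=.
rewrite sum_osign_incidence ?card_triangle // mulr_sumr.
by apply: eq_bigr => z _; rewrite mulrCA.
Qed.

Lemma oriented_valueC u x y z : oriented_value u x z y = - oriented_value u x y z.
Proof.
rewrite /oriented_value -(osign3_rot R x z y) osign3C osign3_rot mulNr.
by rewrite (set3_rot x z y) set3C -set3_rot.
Qed.

(* The two orientations of a triangle at [x] contribute opposite values. *)
Lemma sum_boundary u x : \sum_y boundary u x y = 0.
Proof.
under eq_bigr do rewrite boundary_sum.
apply: sum_skew => [y|y z]; last exact: oriented_valueC.
by rewrite /oriented_value /osign3 osign_refl mulr0 !mul0r.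
Qed.

Lemma sum_boundary_setC u x (A : {set 'I_n}) :
  \sum_(y in A) boundary u x y = - \sum_(y in ~: A) boundary u x y.
Proof.
have /eqP := sum_boundary u x; rewrite (bigID (mem A)) /= addr_eq0 => /eqP->.
by under [in RHS]eq_bigl do rewrite in_setC.
Qed.

Lemma mul_down_laplacian2 u t x y z : enum_val t = [set x; y; z] ->
  osign3 R x y z * (u *m down_laplacian2 R E) 0 t =
    boundary u x y + boundary u y z + boundary u z x.
Proof.
move=> tE; have := enum_valP t; rewrite tE set3_triangle => /and4P[xyz Exy Eyz Ezx].
pose F e := \sum_s u 0 s * incidence R (enum_val s) e.
have boundaryF i j : boundary u i j = osign R i j * F [set i; j].
  by rewrite mxE mulr_sumr; apply: eq_bigr => s _; rewrite mulrCA.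
have sumF i j : [set i; j] \in E ->
    \sum_(e in E) F e * (osign R i j * (e == [set i; j])%:R) = boundary u i j.
  move=> ijE; rewrite (bigD1 [set i; j]) //= eqxx mulr1 big1 ?addr0 => [|e].
    by rewrite boundaryF mulrC.
  by case/andP=> _ /negPf->; rewrite !mulr0.
have -> : (u *m down_laplacian2 R E) 0 t =
    \sum_(e in E) F e * incidence R [set x; y; z] e.
  rewrite mulmxA mxE [RHS]big_enum_val; apply: eq_bigr => e _; rewrite !mxE -tE.
  by congr (_ * _); apply: eq_bigr => s _; rewrite mxE.
rewrite mulr_sumr; under eq_bigr do rewrite mulrCA incidence_set3 // !mulrDr.
by rewrite !big_split /= !sumF.
Qed.

Lemma mul_down_laplacian2_eq0 u : boundary u = 0 -> u *m down_laplacian2 R E = 0.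
Proof.
move=> u0; apply/rowP => t; rewrite [RHS]mxE.
have [x [y [z [xyz tE]]]] := triangle_set3 t.
rewrite -[LHS](osign3K xyz) (mul_down_laplacian2 u tE) u0 !mxE.
by rewrite !addr0 mulr0.
Qed.

Lemma boundary_laplacian u x y :
  boundary (u *m down_laplacian2 R E) x y =
    \sum_(z | [set x; y; z] \in triangles E)
      (boundary u x y + boundary u y z + boundary u z x).
Proof.
rewrite boundary_sum [RHS]big_mkcond; apply: eq_bigr => z _ /=.
case: ifPn => [zE|]; last exact: oriented_value_eq0.
have tE := enum_rankK_in zE zE.
by rewrite (oriented_valueE _ tE) (mul_down_laplacian2 u tE).
Qed.

End Boundary.

Lemma trace_down_laplacian2 (R : comPzRingType) (n : nat) (E : {set {set 'I_n}}) :
  \tr (down_laplacian2 R E) = (3 * #|triangles E|)%:R.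
Proof.
rewrite natrM mulr_natr -[X in _ *+ X]card_ord -sumr_const; apply: eq_bigr => t _.
have [x [y [z [xyz tE]]]] := triangle_set3 t.
have -> : down_laplacian2 R E t t =
    (delta_mx 0 t *m down_laplacian2 R E : 'rV_#|triangles E|) 0 t.
  by rewrite -rowE [RHS]mxE.
have boundary_delta i j k : uniq [:: i; j; k] -> enum_val t = [set i; j; k] ->
    boundary (delta_mx 0 t : 'rV[R]_#|triangles E|) i j = osign3 R i j k.
  move=> ijk tE_ijk; rewrite mxE (bigD1 t) //= mxE !eqxx mul1r tE_ijk.
  by rewrite osign_incidence // big1 ?addr0 // => s /negPf st; rewrite mxE st andbF mul0r.
have [yzx zxy] : uniq [:: y; z; x] /\ uniq [:: z; x; y].
  by split; [rewrite -(rot_uniq 2) | rewrite -(rot_uniq 1)].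
have tE_yzx : enum_val t = [set y; z; x] by rewrite tE set3_rot.
have tE_zxy : enum_val t = [set z; x; y] by rewrite tE_yzx set3_rot.
rewrite -[LHS](osign3K xyz) (mul_down_laplacian2 _ tE).
rewrite (boundary_delta x y z) // (boundary_delta y z x) // (boundary_delta z x y) //.
rewrite (osign3_rot R y z x) (osign3_rot R x y z) -[RHS](osign3K xyz).
by ring.
Qed.

Lemma rank_leq_card_edges (F : fieldType) (n p : nat) (E D : {set {set 'I_n}})
    (A : 'M[F]_(#|triangles E|, p)) :
    (forall u : 'rV_#|triangles E|,
      (forall x y, [set x; y] \in D -> boundary u x y = 0) -> u *m A = 0) ->
  (\rank A <= #|D|)%N.
Proof.
move=> kerA; pose K : 'M[F]_(#|triangles E|, #|D|) :=
  \matrix_(t, k) incidence F (enum_val t) (enum_val k).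
apply: leq_trans (rank_leq_col K); apply/leq_mxrank_kermx/rV_subP => u /sub_kermxP uK.
apply/sub_kermxP/kerA => x y xyD; rewrite mxE.
under eq_bigr do rewrite mulrCA; rewrite -mulr_sumr.
have /rowP/(_ (enum_rank_in xyD [set x; y])) := uK; rewrite !mxE => uK0.
rewrite -[RHS](mulr0 (osign F x y)) -[in RHS]uK0; congr (_ * _).
by apply: eq_bigr => t _; rewrite mxE enum_rankK_in.
Qed.

(* A cycle is determined by its values on the edges avoiding a given vertex. *)
Lemma rank_down_laplacian2_leq (F : fieldType) (n : nat) (E : {set {set 'I_n}})
    (x0 : 'I_n) :
  (\rank (down_laplacian2 F E) <= #|[set e in E | x0 \notin e]|)%N.
Proof.
apply: rank_leq_card_edges => u u0; apply: mul_down_laplacian2_eq0.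
have u_avoid x y : x != x0 -> y != x0 -> boundary u x y = 0.
  move=> xx0 yx0; have [xyE|] := boolP ([set x; y] \in E); last exact: boundary_nonedge.
  by apply: u0; rewrite !inE xyE negb_or ![x0 == _]eq_sym xx0.
have u_x0 x : boundary u x x0 = 0.
  have [->|xx0] := eqVneq x x0; first exact: boundary_refl.
  rewrite -[RHS](sum_boundary u x) (bigD1 x0) //= big1 ?addr0 // => y.
  exact: u_avoid.
apply/matrixP => x y; rewrite [RHS]mxE; have [->|yx0] := eqVneq y x0; first exact: u_x0.
have [->|xx0] := eqVneq x x0; last exact: u_avoid.
by rewrite boundaryC u_x0 oppr0.
Qed.

(** * Complete split graphs *)

(* The [k]-cliques of the graph joining a clique on [C] to an independent set on
   its complement. *)
Definition split_cliques (T : finType) (C : {set T}) (k : nat) : {set {set T}} :=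
  [set A : {set T} | (#|A| == k) && (#|A :\: C| <= 1)%N].

Lemma card_setD_leq1P (T : finType) (A C : {set T}) :
  reflect {in A &, forall x y, x != y -> (x \in C) || (y \in C)} (#|A :\: C| <= 1)%N.
Proof.
apply: (iffP idP) => [AC x y xA yA xy|C_cover].
  apply: contraLR AC; rewrite negb_or -ltnNge => /andP[xC yC].
  by apply/card_gt1P; exists x, y; rewrite !inE xC yC.
rewrite leqNgt; apply/card_gt1P => -[x [y []]].
rewrite !inE => /andP[/negPf xC xA] /andP[/negPf yC yA] xy.
by have := C_cover x y xA yA xy; rewrite xC yC.
Qed.

Lemma card_split_cliques (T : finType) (C : {set T}) (k : nat) :
  #|split_cliques C k.+1| = ('C(#|C|, k.+1) + #|~: C| * 'C(#|C|, k))%N.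
Proof.
rewrite -(cardsID (powerset C)) -!cards_draws -cardsX; congr (_ + _)%N.
  apply: eq_card => A; rewrite !inE andbC; apply: andb_id2l => AC.
  by rewrite setDE; move: AC; rewrite -setD_eq0 setDE => /eqP->; rewrite cards0 andbT.
pose insert (q : T * {set T}) := q.1 |: q.2.
have insertK q : q \in setX (~: C) [set A : {set T} | A \subset C & #|A| == k] ->
    insert q :&: C = q.2 /\ insert q :\: C = [set q.1].
  case: q => p A; rewrite !inE /= => /and3P[pC AC _]; rewrite /insert setIUl setDUl.
  have /eqP-> : A :\: C == set0 by rewrite setD_eq0.
  rewrite (setIidPl AC) setU0; split.
    by rewrite (_ : _ :&: C = set0) ?set0U //; apply/eqP; rewrite setI_eq0 disjoints1.
  by apply/setDidPl; rewrite disjoints1.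
rewrite -(@card_in_imset _ _ insert); last first.
  move=> p q /insertK[pC pD] /insertK[qC qD] pq.
  apply/eqP; rewrite -pair_eqE /= -pC -qC pq eqxx andbT -(inj_eq set1_inj) -pD -qD pq.
  by rewrite eqxx.
apply: eq_card => A; apply/idP/imsetP => [|[[p B] pB ->]].
  rewrite !inE -setD_eq0 -cards_eq0 => /and3P[AC_neq0 /eqP A_k AC_le1].
  have /cards1P[p AC] : #|A :\: C| == 1 by lia.
  exists (p, A :&: C); last by rewrite /insert -AC setUC setID.
  have /setP/(_ p) := AC; rewrite !inE eqxx => /andP[pC _].
  by rewrite /= pC subsetIr -eqSS -A_k -(cardsID C A) AC cards1 addn1 eqxx.
have [_ pBD] := insertK _ pB; move: pB; rewrite !inE /= => /and3P[pC BC /eqP B_k].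
rewrite -setD_eq0 pBD cards1 -cards_eq0 cards1 andbT /insert cardsU1 /= B_k.
by rewrite (contra _ pC) // => /(subsetP BC).
Qed.

Lemma set2_split_edge (T : finType) (C : {set T}) (x y : T) :
  ([set x; y] \in split_cliques C 2) = (x != y) && ((x \in C) || (y \in C)).
Proof.
rewrite inE cards2 eqSS eqb1; apply: andb_id2l => xy.
apply/card_setD_leq1P/idP => [/(_ x y)|xyC p q].
  by apply; rewrite // !inE eqxx ?orbT.
by rewrite !inE => /orP[]/eqP-> /orP[]/eqP->; rewrite ?eqxx // orbC.
Qed.

Lemma triangles_split_edges (n : nat) (C : {set 'I_n}) :
  triangles (split_cliques C 2) = split_cliques C 3.
Proof.
apply/setP => T; rewrite !inE; apply: andb_id2l => _.
apply/forall_inP/card_setD_leq1P => [cliqueT x y xT yT xy|CT x xT].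
  have /forall_inP/(_ y yT)/implyP/(_ xy) := cliqueT x xT.
  by rewrite set2_split_edge xy.
apply/forall_inP => y yT; apply/implyP => xy.
by rewrite set2_split_edge xy CT.
Qed.

Lemma card_split_edges_avoiding (T : finType) (C : {set T}) (x0 : T) : x0 \in C ->
  (#|[set e in split_cliques C 2 | x0 \notin e]| + #|T|.-1 = #|split_cliques C 2|)%N.
Proof.
move=> x0C; rewrite -(cardsC1 x0).
rewrite -(@card_in_imset _ _ (fun y => [set x0; y])); last first.
  move=> y z; rewrite !inE => yx0 zx0 /setP/(_ y).
  by rewrite !inE eqxx orbT (negPf yx0) => /esym/eqP.
rewrite -[RHS](cardsID [set e : {set T} | x0 \notin e]); congr (_ + _)%N.
  by apply: eq_card => e; rewrite !inE.
apply: eq_card => e; apply/imsetP/idP => [[y yx0 ->]|].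
  by move: yx0; rewrite in_setD set2_split_edge !inE eqxx x0C andbT (eq_sym x0).
rewrite !inE negbK => /andP[x0e /andP[/cards2P[x [y [xy eE]]] _]].
move: x0e; rewrite eE !inE => /orP[]/eqP->; [exists y | exists x];
  by rewrite ?inE ?(eq_sym y) // setUC.
Qed.

Lemma natr_cardsC (R : pzSemiRingType) (n : nat) (C : {set 'I_n}) :
  n%:R = #|C|%:R + #|~: C|%:R :> R.
Proof. by rewrite -natrD cardsC card_ord. Qed.

Section SplitLaplacian.

Variables (R : comPzRingType) (n : nat) (C : {set 'I_n}).
Let E := split_cliques C 2.
Let L := down_laplacian2 R E.
Implicit Types (u : 'rV[R]_#|triangles E|) (x y z : 'I_n).

Lemma boundary_independent u x y :
  x \notin C -> y \notin C -> boundary u x y = 0.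
Proof.
move=> /negPf xC /negPf yC.
by apply: boundary_nonedge; rewrite set2_split_edge xC yC andbF.
Qed.

Lemma boundary_split_eq0 u :
  {in C, forall x y, boundary u x y = 0} -> boundary u = 0.
Proof.
move=> u0; apply/matrixP => x y; rewrite [RHS]mxE.
have [xC|xC] := boolP (x \in C); first exact: u0.
have [yC|yC] := boolP (y \in C); last exact: boundary_independent.
by rewrite boundaryC u0 ?oppr0.
Qed.

Lemma boundary_laplacian_split u x y : x \in C ->
  boundary (u *m L) x y =
    \sum_(z | (y \in C) || (z \in C))
      (boundary u x y + boundary u y z + boundary u z x).
Proof.
move=> xC; rewrite boundary_laplacian [LHS]big_mkcond [RHS]big_mkcond.
apply: eq_bigr => z _; rewrite set3_triangle uniq3 !set2_split_edge xC orbT /= !andbT.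
have [<-|xy] := eqVneq x y.
  by rewrite xC boundary_refl add0r [X in _ + X]boundaryC subrr.
have [<-|xz] := eqVneq x z.
  by rewrite xC orbT boundary_refl addr0 (boundaryC _ x) addrN.
have [<-|yz] := eqVneq y z; last by rewrite /= andbT.
by rewrite boundary_refl addr0 (boundaryC _ x) addrN if_same.
Qed.

Lemma boundary_laplacian_clique u x y : x \in C -> y \in C ->
  boundary (u *m L) x y = n%:R * boundary u x y.
Proof.
move=> xC yC; rewrite boundary_laplacian_split // yC !big_split /= sum_boundary.
under [X in _ + X]eq_bigr do rewrite boundaryC.
by rewrite sumrN sum_boundary oppr0 !addr0 sumr_const card_ord mulr_natl.
Qed.

Lemma boundary_laplacian_cross u x y : x \in C -> y \notin C ->
  boundary (u *m L) x y = #|C|%:R * boundary u x y + \sum_(z in ~: C) boundary u x z.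
Proof.
move=> xC yC; rewrite boundary_laplacian_split // (negPf yC) !big_split /=.
rewrite sumr_const mulr_natl sum_boundary_setC big1 => [|z].
  under [X in _ + X = _]eq_bigr do rewrite boundaryC.
  by rewrite sumrN sum_boundary_setC oppr0 opprK addr0.
by rewrite in_setC; exact: boundary_independent.
Qed.

Lemma boundary_mul_shift u (a : R) x y :
  boundary (u *m (L - a%:M)) x y = boundary (u *m L) x y - a * boundary u x y.
Proof. by rewrite mulmxBr mul_mx_scalar boundaryBZ. Qed.

Lemma boundary_shift_clique u x y : x \in C -> y \in C ->
  boundary (u *m (L - #|C|%:R%:M)) x y = #|~: C|%:R * boundary u x y.
Proof.
move=> xC yC; rewrite boundary_mul_shift boundary_laplacian_clique // (natr_cardsC R C).
by rewrite mulrDl addrC addKr.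
Qed.

Lemma boundary_shift_cross u x y : x \in C -> y \notin C ->
  boundary (u *m (L - #|C|%:R%:M)) x y = \sum_(z in ~: C) boundary u x z.
Proof.
by move=> xC yC; rewrite boundary_mul_shift boundary_laplacian_cross // addrC addKr.
Qed.

Lemma boundary_shift2_eq0 u :
  boundary (u *m (L - #|C|%:R%:M) *m (L - n%:R%:M)) = 0.
Proof.
apply: boundary_split_eq0 => x xC y; rewrite boundary_mul_shift; apply/eqP.
set v := u *m _; rewrite subr_eq0; apply/eqP; have [yC|yC] := boolP (y \in C).
  exact: boundary_laplacian_clique.
have v_cross z : z \notin C -> boundary v x z = \sum_(q in ~: C) boundary u x q.
  exact: boundary_shift_cross.
rewrite boundary_laplacian_cross // v_cross //.
rewrite [X in _ + X](eq_bigr (fun=> \sum_(q in ~: C) boundary u x q)) => [|z].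
  by rewrite sumr_const (natr_cardsC R C) mulrDl !mulr_natl.
by rewrite in_setC; exact: v_cross.
Qed.

Lemma down_laplacian2_split_annihilator :
  \prod_(a <- [:: 0; #|C|%:R; n%:R]) (L - a%:M) = 0.
Proof.
have product_kills u : u *m (L - #|C|%:R%:M) *m (L - n%:R%:M) *m L = 0.
  exact/mul_down_laplacian2_eq0/boundary_shift2_eq0.
have comm a : L *m (L - a%:M) = (L - a%:M) *m L.
  by rewrite mulmxBr mulmxBl scalar_mxC.
rewrite !big_cons big_nil mulr1 raddf0 subr0 -!mulmxE mulmxA comm -mulmxA comm mulmxA.
apply/row_matrixP => t; rewrite row0 rowE [LHS]mulmxA [X in X *m L]mulmxA.
by rewrite product_kills.
Qed.

End SplitLaplacian.

Lemma rank_shift_laplacian_split_leq (F : fieldType) (n : nat) (C : {set 'I_n}) :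
  (\rank ((down_laplacian2 F (split_cliques C 2) - #|C|%:R%:M)
          *m down_laplacian2 F (split_cliques C 2)) <= 'C(#|C|, 2))%N.
Proof.
set L := down_laplacian2 _ _; rewrite -cards_draws; apply: rank_leq_card_edges => u u0.
have u_clique x y : x \in C -> y \in C -> boundary u x y = 0.
  move=> xC yC; have [->|xy] := eqVneq x y; first exact: boundary_refl.
  by apply: u0; rewrite inE subUset !sub1set xC yC cards2 xy.
rewrite mulmxA; apply: mul_down_laplacian2_eq0.
apply: boundary_split_eq0 => x xC y; have [yC|yC] := boolP (y \in C).
  by rewrite boundary_shift_clique // u_clique // mulr0.
rewrite boundary_shift_cross // -[LHS]opprK -sum_boundary_setC big1 ?oppr0 // => z.
exact: u_clique.
Qed.

Lemma rank_eigenspace_split_leq (F : numFieldType) (n : nat) (C : {set 'I_n}) :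
    (0 < #|~: C|)%N ->
  (\rank (eigenspace (down_laplacian2 F (split_cliques C 2)) n%:R) <= 'C(#|C|, 2))%N.
Proof.
move=> b_gt0; set L := down_laplacian2 _ _; set W := eigenspace L _.
have /eigenspaceP WL : (W <= eigenspace L n%:R)%MS by exact: submx_refl.
apply: leq_trans (rank_shift_laplacian_split_leq F C); apply: mxrankS.
have scalar_neq0 : (n%:R - #|C|%:R) * n%:R != 0 :> F.
  rewrite (natr_cardsC F C) addrC addKr -natrD mulf_neq0 // pnatr_eq0; lia.
rewrite -(eqmx_scale W scalar_neq0) -scalerA -WL scalemxAl scalerBl -WL -mul_mx_scalar.
by rewrite -mulmxBr -mulmxA submxMl.
Qed.

Lemma eq_of_leq_lincomb (p q m1 m2 M1 M2 : nat) :
    (0 < p)%N -> (0 < q)%N -> (m1 <= M1)%N -> (m2 <= M2)%N ->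
    (m1 * p + m2 * q = M1 * p + M2 * q)%N ->
  m1 = M1 /\ m2 = M2.
Proof.
move=> p_gt0 q_gt0 le1 le2 combE.
have le1p : (m1 * p <= M1 * p)%N by rewrite leq_mul2r le1 orbT.
have le2q : (m2 * q <= M2 * q)%N by rewrite leq_mul2r le2 orbT.
by split; apply/eqP; [rewrite -(eqn_pmul2r p_gt0) | rewrite -(eqn_pmul2r q_gt0)]; lia.
Qed.

(* [mc + mn] is the rank, and the trace [mc * c + mn * n] is a positive
   combination of [mc + mn] and [mn] that equals its value at their upper bounds. *)
Lemma split_multiplicities (c b n m0 mc mn : nat) :
    (0 < c)%N -> (0 < b)%N -> (b + c = n)%N ->
    (m0 + mc + mn = 'C(c, 3) + b * 'C(c, 2))%N ->
    (mc + mn + n.-1 <= 'C(c, 2) + b * c)%N -> (mn <= 'C(c, 2))%N ->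
    (mc * c + mn * n = 3 * ('C(c, 3) + b * 'C(c, 2)))%N ->
  [/\ m0 = ('C(c, 3) + (b - 1) * 'C(c - 1, 2))%N, mc = ((b - 1) * (c - 1))%N
    & mn = 'C(c, 2)].
Proof.
case: c => // c; case: b => // b _ _ <- sizeE rank_le mn_le traceE; rewrite !subn1 /=.
have bin3 : (c.+1 * 'C(c, 2) = 3 * 'C(c.+1, 3))%N := mul_bin_diag c.+1 2.
have bin2 : (c.+1 * c = 2 * 'C(c.+1, 2))%N.
  by have := mul_bin_diag c.+1 1; rewrite /= bin1.
have binS2 : 'C(c.+1, 2) = ('C(c, 2) + c)%N by rewrite binS bin1.
have bound_traceE : ((b * c + 'C(c.+1, 2)) * c.+1 + 'C(c.+1, 2) * b.+1 =
                     3 * ('C(c.+1, 3) + b.+1 * 'C(c.+1, 2)))%N.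
  have : ('C(c.+1, 2) * c.+1 = 3 * 'C(c.+1, 3) + 2 * 'C(c.+1, 2))%N.
    by rewrite {1}binS2 mulnDl; lia.
  have : (b * c * c.+1 = b * (2 * 'C(c.+1, 2)))%N by rewrite -bin2; lia.
  by lia.
have [mcnE mnE] : (mc + mn)%N = (b * c + 'C(c.+1, 2))%N /\ mn = 'C(c.+1, 2).
  by apply: (@eq_of_leq_lincomb c.+1 b.+1) => //; lia.
split=> //; last by lia.
by have : (b * 'C(c.+1, 2) = b * 'C(c, 2) + b * c)%N by [rewrite binS2 mulnDr]; lia.
Qed.

Lemma down_laplacian2_split_spectrum (F : numFieldType) (n : nat) (C : {set 'I_n}) :
    (0 < #|C|)%N -> (0 < #|~: C|)%N ->
  has_spectrum (down_laplacian2 F (split_cliques C 2))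
    (nseq ('C(#|C|, 3) + (#|~: C| - 1) * 'C(#|C| - 1, 2))%N 0
     ++ nseq ((#|~: C| - 1) * (#|C| - 1))%N #|C|%:R
     ++ nseq 'C(#|C|, 2) n%:R).
Proof.
move=> c_gt0 b_gt0; set L := down_laplacian2 _ _.
have nE : (#|~: C| + #|C| = n)%N by rewrite addnC cardsC card_ord.
have c_neq0 : #|C|%:R != 0 :> F by rewrite pnatr_eq0; lia.
have n_neq0 : n%:R != 0 :> F by rewrite pnatr_eq0; lia.
have eigs_uniq : uniq [:: 0; #|C|%:R; n%:R : F].
  by rewrite uniq3 ![0 == _]eq_sym c_neq0 n_neq0 eqr_nat; lia.
have spec := annihilated_has_spectrum eigs_uniq (down_laplacian2_split_annihilator F C).
rewrite /= cats0 -/L in spec; set m0 := \rank (eigenspace L 0) in spec.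
set mc := \rank (eigenspace L #|C|%:R) in spec; set mn := \rank _ in spec.
have sizeE : (m0 + mc + mn = 'C(#|C|, 3) + #|~: C| * 'C(#|C|, 2))%N.
  rewrite -card_split_cliques -triangles_split_edges -(has_spectrum_size spec).
  by rewrite !size_cat !size_nseq addnA.
have traceE : (mc * #|C| + mn * n = 3 * ('C(#|C|, 3) + #|~: C| * 'C(#|C|, 2)))%N.
  apply/eqP; rewrite -card_split_cliques -triangles_split_edges -(eqr_nat F).
  rewrite -trace_down_laplacian2 (has_spectrum_trace spec) !big_cat !big_nseq /=.
  by rewrite !iter_addr_0 mul0rn add0r natrD !natrM !mulr_natl.
have rankL : \rank L = (mc + mn)%N.
  rewrite (has_spectrum_rank spec) !count_cat !count_nseq /= eqxx c_neq0 n_neq0.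
  by rewrite mul0n !mul1n.
have rank_le : (mc + mn + n.-1 <= 'C(#|C|, 2) + #|~: C| * #|C|)%N.
  have [x0 x0C] := card_gt0P c_gt0.
  rewrite -[X in (_ * X)%N]bin1 -card_split_cliques -(card_split_edges_avoiding x0C).
  rewrite card_ord leq_add2r -rankL; exact: rank_down_laplacian2_leq.
have mn_le : (mn <= 'C(#|C|, 2))%N by exact: rank_eigenspace_split_leq.
by have [<- <- <-] := split_multiplicities c_gt0 b_gt0 nE sizeE rank_le mn_le traceE.
Qed.

Lemma Gedges_split (c b : nat) :
  Gedges c b = split_cliques [set x : 'I_(b + c) | (x < c)%N] 2.
Proof.
apply/setP => e; rewrite [LHS]inE; apply/existsP/idP => [[i /existsP[j]]|eE].
  by case/andP=> /eqP-> ij; rewrite set2_split_edge !inE -val_eqE /=; lia.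
have /cards2P[x [y [xy exy]]] : #|e| == 2 by move: eE; rewrite inE => /andP[].
move: eE; rewrite exy set2_split_edge xy !inE /=.
wlog yc : x y xy exy / (y < c)%N => [ordered /orP[xc|yc]|_].
- by rewrite setUC; apply: ordered; rewrite ?xc ?orbT // 1?eq_sym // setUC.
- by apply: ordered; rewrite ?yc ?orbT.
have [yx|xy_le] := ltnP y x.
  have [xc|xc] := ltnP x c.
    by exists y; apply/existsP; exists x; rewrite setUC eqxx yx xc.
  by exists x; apply/existsP; exists y; rewrite eqxx xc yc orbT.
exists x; apply/existsP; exists y; rewrite eqxx yc andbT ltn_neqAle xy_le.
by rewrite -(inj_eq val_inj) in xy; rewrite xy.
Qed.

Lemma card_ord_lt (n k : nat) : (k <= n)%N -> #|[set x : 'I_n | (x < k)%N]| = k.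
Proof.
move=> kn; rewrite -sum1_card; under eq_bigl do rewrite inE.
by rewrite (big_ord_narrow kn) sum1_card card_ord.
Qed.

Theorem theorem3p19 (R : numFieldType) (c b : nat)
    (hc : (3 <= c)%N) (hb : (1 <= b)%N) :
  has_spectrum (down_laplacian2 R (Gedges c b))
    (nseq ('C(c, 3) + (b - 1) * 'C(c - 1, 2))%N 0
     ++ nseq ((b - 1) * (c - 1))%N c%:R
     ++ nseq 'C(c, 2) (b + c)%:R).
Proof.
pose C := [set x : 'I_(b + c) | (x < c)%N].
have cE : #|C| = c := card_ord_lt (leq_addl b c).
have bE : #|~: C| = b by rewrite cardsCs setCK cE card_ord addnK.
have := @down_laplacian2_split_spectrum R _ C.
by rewrite Gedges_split cE bE; apply=> //; exact: ltnW (ltnW hc).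
Qed.
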